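(* Let $A\in\mathbb{C}^{n\times n}$ and let $G,H\in\mathbb{C}^{n\times n}$ be Hermitian with $G\geq 0$ and $H\geq 0$. Then any positive definite solution $X$ of $$X=H+A^\ast X(I+GX)^{-1}A$$ is an almost stabilizing solution. Furthermore, $X$ is a stabilizing solution if $H>0$.
   Context: $\ast$ denotes conjugate transpose; $M\geq 0$ (resp. $M>0$) means that $M$ is Hermitian positive semidefinite (resp. positive definite). A Hermitian solution $X$ of the equation is called stabilizing (respectively, almost stabilizing) if all eigenvalues of $T_X:=(I+GX)^{-1}A$ lie in the open (respectively, closed) unit disk. *)

(* Defs.v *)
From HB Require Import structures.
From mathcomp Require Import all_boot all_order all_algebra.
From mathcomp Require Import reals complex.

Set Implicit Arguments.
Unset Strict Implicit.
Unset Printing Implicit Defensive.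

Import Order.TTheory GRing.Theory Num.Theory.
Local Open Scope ring_scope.
Local Open Scope sesquilinear_scope.
Local Open Scope complex_scope.

(* In the partial order of [R[i]], [0 <= z] and [0 < z] entail that [z] is
   real. *)
Definition psdmx (R : realType) (n : nat) (M : 'M[R[i]]_n) : Prop :=
  M \is hermsymmx /\ forall v : 'cV[R[i]]_n, 0 <= (v ^t* *m M *m v) 0 0.

Definition pdmx (R : realType) (n : nat) (M : 'M[R[i]]_n) : Prop :=
  M \is hermsymmx /\
  forall v : 'cV[R[i]]_n, v != 0 -> 0 < (v ^t* *m M *m v) 0 0.

(* [invmx M] is [M] when [M] is singular, so a solution is required to make
   [I + G X] invertible. *)
Definition dare_solution (R : realType) (n : nat) (A G H X : 'M[R[i]]_n) :
    Prop :=
  (1%:M + G *m X) \in unitmx /\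
  X = H + A ^t* *m X *m invmx (1%:M + G *m X) *m A.

Definition closed_loop (R : realType) (n : nat) (A G X : 'M[R[i]]_n) :
    'M[R[i]]_n :=
  invmx (1%:M + G *m X) *m A.

(* [eigenvalue] is stated with row eigenvectors; a square matrix has the same
   eigenvalues on the left and on the right. *)
Definition stabilizing (R : realType) (n : nat) (A G H X : 'M[R[i]]_n) :
    Prop :=
  [/\ X \is hermsymmx, dare_solution A G H X &
      forall z : R[i], eigenvalue (closed_loop A G X) z -> `|z| < 1].

Definition almost_stabilizing (R : realType) (n : nat)
    (A G H X : 'M[R[i]]_n) : Prop :=
  [/\ X \is hermsymmx, dare_solution A G H X &
      forall z : R[i], eigenvalue (closed_loop A G X) z -> `|z| <= 1].

(* Main.v *)
(** If [X] is a solution and [S = I + G X], [T = S^-1 A], then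
    [X - T^* X T = H + T^* X G X T]. Evaluated at an eigenvector [v] of [T] with
    eigenvalue [z] this reads
    [(1 - |z|^2) v^* X v = v^* H v + |z|^2 (X v)^* G (X v)],
    and [v^* X v > 0] forces the sign of [1 - |z|^2]. *)
Require Import Defs.
From HB Require Import structures.
From mathcomp Require Import all_boot all_order all_algebra.
From mathcomp Require Import reals complex.

Set Implicit Arguments.
Unset Strict Implicit.
Unset Printing Implicit Defensive.

Import Order.TTheory GRing.Theory Num.Theory.
Local Open Scope ring_scope.
Local Open Scope complex_scope.

(** A square matrix and its transpose are singular together, here [M - z I]. *)
Lemma eigenvalue_trmx (F : fieldType) (n : nat) (M : 'M[F]_n) (z : F) :
  eigenvalue M^T z = eigenvalue M z.
Proof.
rewrite /eigenvalue /eigenspace !kermx_eq0 !row_free_unit -unitmx_tr.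
by rewrite linearB /= trmxK tr_scalar_mx.
Qed.

(** Supplies the column vectors on which the quadratic forms [v^* M v] are evaluated. *)
Lemma eigenvalue_colP (F : fieldType) (n : nat) (M : 'M[F]_n) (z : F) :
  eigenvalue M z -> exists2 v : 'cV_n, M *m v = z *: v & v != 0.
Proof.
rewrite -eigenvalue_trmx => /eigenvalueP[u uM u0].
exists u^T; last by rewrite trmx_eq0.
by apply: trmx_inj; rewrite trmx_mul linearZ /= !trmxK.
Qed.

Section ConjugateTranspose.
Local Open Scope sesquilinear_scope.
Variable C : numClosedFieldType.

Lemma trmxC_mul (m n p : nat) (A : 'M[C]_(m, n)) (B : 'M_(n, p)) :
  (A *m B) ^t* = B ^t* *m A ^t*.
Proof. by rewrite trmx_mul map_mxM. Qed.

Lemma trmxCD (m n : nat) (A B : 'M[C]_(m, n)) : (A + B) ^t* = A ^t* + B ^t*.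
Proof. by rewrite linearD /= map_mxD. Qed.

Lemma trmxCZ (m n : nat) (z : C) (A : 'M[C]_(m, n)) :
  (z *: A) ^t* = z^* *: A ^t*.
Proof. by rewrite linearZ /= map_mxZ. Qed.

Lemma hermsymmx_trmxC (n : nat) (A : 'M[C]_n) : A \is hermsymmx -> A ^t* = A.
Proof. by rewrite qualifE /= expr0 scale1r => /eqP <-. Qed.

Lemma dare_eigenvector (n : nat) (A G H X : 'M[C]_n) (v : 'cV_n) (z : C) :
    G \is hermsymmx -> 1%:M + G *m X \in unitmx ->
    X = H + A ^t* *m X *m invmx (1%:M + G *m X) *m A ->
    invmx (1%:M + G *m X) *m A *m v = z *: v ->
  (1 - `|z| ^+ 2) * (v ^t* *m X *m v) 0 0 =
    (v ^t* *m H *m v) 0 0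
    + `|z| ^+ 2 * ((X *m v) ^t* *m G *m (X *m v)) 0 0.
Proof.
move=> /hermsymmx_trmxC Gh; set S := _ + _ => Su Xeq Tv.
(* Since [A = S T], the relation [T v = z v] becomes [A v = z S v], free of the inverse. *)
have Av : A *m v = z *: (v + G *m (X *m v)).
  rewrite -(mulKVmx Su (A *m v)) [invmx S *m _]mulmxA Tv -scalemxAr.
  by rewrite mulmxDl mul1mx mulmxA.
have AvC : v ^t* *m A ^t* = z^* *: (v ^t* + (X *m v) ^t* *m G).
  by rewrite -trmxC_mul Av trmxCZ trmxCD (trmxC_mul G) Gh.
(* The equation expands only the unweighted [v^* X v]; the copy weighted by [|z|^2] is kept for the
   final cancellation. *)
rewrite mulrBl mul1r {1}Xeq mulmxDr mulmxDl.
have -> : v ^t* *m (A ^t* *m X *m invmx S *m A) *m v =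
    v ^t* *m A ^t* *m X *m (invmx S *m A *m v) by rewrite !mulmxA.
rewrite Tv AvC -!scalemxAl -scalemxAr scalerA -normCKC !mulmxDl.
(* With the three forms abstracted, the two [|z|^2] multiples of [v^* X v] cancel. *)
rewrite -!mulmxA; move: (v ^t* *m _) (v ^t* *m _) (_ *m (G *m _)) => h x g.
by rewrite !mxE mulrDr addrA addrAC addrK.
Qed.

End ConjugateTranspose.

Theorem theorem3p1 (R : realType) (n : nat) (A G H : 'M[R[i]]_n)
    (hG : psdmx G) (hH : psdmx H) (X : 'M[R[i]]_n)
    (hX : pdmx X) (hsol : dare_solution A G H X) :
  almost_stabilizing A G H X /\ (pdmx H -> stabilizing A G H X).
Proof.
have [[Gh G_ge0] [_ H_ge0]] := (hG, hH).
have [[Xh X_gt0] [Su Xeq]] := (hX, hsol).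
split=> [|[_ H_gt0]]; split=> // z /eigenvalue_colP[v Tv v0];
  have := dare_eigenvector Gh Su Xeq Tv => eqv.
(* Multiplying by [v^* X v > 0] preserves the sign of [1 - |z|^2]. *)
- rewrite -(@expr_le1 _ 2) // -subr_ge0 -(pmulr_lge0 _ (X_gt0 v v0)) eqv.
  by rewrite addr_ge0 // mulr_ge0 ?exprn_ge0.
(* Strictness comes from [v^* H v > 0] alone; the [G] term is only nonnegative. *)
- rewrite -(@expr_lt1 _ 2) // -subr_gt0 -(pmulr_lgt0 _ (X_gt0 v v0)) eqv.
  by rewrite ltr_wpDr ?H_gt0 // mulr_ge0 ?exprn_ge0.
Qed.
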